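(* Let $T,S,\varphi_n,\psi_n,\gamma_n$ be as in the context, with $\gamma_n\ne0$ for all $n\ge0$, and let $\gamma=\lim_{n\to\infty}|\gamma_n|$ (possibly $\gamma=\infty$). Assume that there exist four positive constants $A_\varphi,A_\psi,r_\varphi,r_\psi$ and two strictly positive sequences $\{M_n(\varphi)\}$, $\{M_n(\psi)\}$ such that $$\lim_{n\to\infty}\frac{M_n(\varphi)}{M_{n+1}(\varphi)}=M(\varphi),\qquad \lim_{n\to\infty}\frac{M_n(\psi)}{M_{n+1}(\psi)}=M(\psi),$$ with $M(\varphi)>0$ and $M(\psi)>0$ (possibly infinite), and, for all $n\ge0$, $$\|\varphi_n\|\le A_\varphi r_\varphi^n M_n(\varphi),\qquad \|\psi_n\|\le A_\psi r_\psi^n M_n(\psi).$$ Then the series $\sum_{n=0}^\infty\frac{z^n}{\overline{\gamma_{n-1}!}}\varphi_n$ converges whenever $|z|<\frac{\gamma M(\varphi)}{r_\varphi}$, the series $\sum_{n=0}^\infty z^n\psi_n$ converges whenever $|z|<\frac{M(\psi)}{r_\psi}$, and the series $\Gamma(z)=\sum_{n=0}^\infty\frac{|z|^{2n}}{\gamma_{n-1}!}$ converges whenever $|z|<\sqrt{\gamma}$. Consequently all three converge for $z\in C_\rho(0)=\{z\in\mathbb{C}:|z|<\rho\}$, where $$\rho=\min\left\{\frac{\gamma M(\varphi)}{r_\varphi},\ \frac{M(\psi)}{r_\psi},\ \sqrt{\gamma}\right\}.$$ For $z\in C_\rho(0)$ with $\Gamma(z)\neq0$, choosing $N_\varphi(z),N_\psi(z)$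 such that $\overline{N_\varphi(z)}\,N_\psi(z)=\frac{1}{\Gamma(z)}$, the vectors $$\varphi(z)=N_\varphi(z)\sum_{n=0}^\infty\frac{z^n}{\overline{\gamma_{n-1}!}}\varphi_n,\qquad \psi(z)=N_\psi(z)\sum_{n=0}^\infty z^n\psi_n$$ are well defined in $\mathcal{H}$, satisfy $\langle\varphi(z),\psi(z)\rangle=1$, and $$T\varphi(z)=z\,\varphi(z),\qquad S^\dagger\psi(z)=z\,\psi(z).$$
   Context: $\mathcal{H}$ is a Hilbert space with scalar product $\langle\cdot,\cdot\rangle$ (linear in the second variable) and norm $\|\cdot\|$. $H,T,S$ are operators on $\mathcal{H}$, not necessarily bounded, with adjoints $H^\dagger,T^\dagger,S^\dagger$ ($H\ne H^\dagger$ is allowed), and $\mathcal{D}\subseteq\mathcal{H}$ is a dense subspace which is stable under the action of $H,T,S$ and their adjoints; commutators $[X,Y]=XY-YX$ are understood on $\mathcal{D}$. It is assumed that for some $\lambda\in\mathbb{C}$ one has $[H,S]=\lambda S[T,S]$ and $[H,T]=\lambda[S,T]T$; that $[H,[T,S]]=0$; that all the eigenvalues of $H$ are non-degenerate (multiplicity one); that a non-zero $\varphi_0\in\mathcal{D}$ exists with $H\varphi_0=0$; that the vectors $\varphi_n=S^n\varphi_0$, $n\ge0$, are all non-zero; that $[T,S]\varphi_n=\mu_n\varphi_n$ with $\mu_n\ne0$ for all $n\ge0$ (the proportionality itself follows from the preceding assumptions); and that $\{\varphi_n,\ n\ge0\}$ is a basis for $\mathcal{H}$. $\{\psi_n,\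 n\ge0\}$ is the unique basis of $\mathcal{H}$ biorthonormal to it, $\langle\varphi_n,\psi_m\rangle=\delta_{n,m}$. In this setting $S^\dagger\psi_0=0$, $S^\dagger\psi_n=\psi_{n-1}$ for $n\ge1$, and $\{\gamma_n\}_{n\ge0}$ is the complex sequence such that $T^\dagger\psi_n=\gamma_n\psi_{n+1}$ for $n\ge0$, $T\varphi_0=0$, and $T\varphi_n=\overline{\gamma_{n-1}}\,\varphi_{n-1}$ for $n\ge1$. Notation: $\gamma_{-1}!=1$ and $\gamma_k!=\gamma_0\gamma_1\cdots\gamma_k$ for $k\ge0$.
   Formalization: T is not assumed closed, so Tφ(z) may be undefined; the equation Tφ(z)=zφ(z) is stated as: (φ(z), zφ(z)) lies in the closure of the graph of T; φ(z) is in the domain of T if T is closed; and Tφ(z)=zφ(z) whenever φ(z) is in that domain. *)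

(* Defs.v *)
From HB Require Import structures.
From mathcomp Require Import all_boot all_order all_algebra.
From mathcomp Require Import all_classical all_reals all_analysis.
From mathcomp Require Import sesquilinear.
From mathcomp.real_closed Require Import complex.
Set Implicit Arguments.
Unset Strict Implicit.
Unset Printing Implicit Defensive.
Import Order.TTheory GRing.Theory Num.Theory.
Import numFieldNormedType.Exports.
Local Open Scope classical_set_scope.
Local Open Scope ring_scope.

(* The norms of R[i] and of normed spaces over R[i] take their values in R[i],
   with zero imaginary part; rnorm is the same norm with values in R. *)
Definition rnorm (R : realType) (V : normedZmodType R[i]) (x : V) : R :=
  complex.Re `|x|.

(* Values of act outside dom carry no meaning. *)
Record operator (C : numDomainType) (E : lmodType C) := Operator {
  dom : set E;
  act :> E -> E;
  dom0 : dom 0;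
  domP : forall (a : C) (x y : E), dom x -> dom y -> dom (a *: x + y);
  actP : forall (a : C) (x y : E), dom x -> dom y ->
    act (a *: x + y) = a *: act x + act y }.

Definition graph (C : numDomainType) (E : lmodType C) (A : operator E) :
  set (E * E) := [set p | dom A p.1 /\ p.2 = A p.1].

(* Library forms are linear in the first variable, whereas the scalar product
   used here is linear in the second one. *)
Definition inner (C : numClosedFieldType) (E : lmodType C)
  (dot : {dot E for (@Num.conj C)}) (x y : E) : C := dot y x.

(* Determines B uniquely on its domain when dom A is dense. *)
Definition is_adjoint (C : numClosedFieldType) (E : lmodType C)
    (dot : {dot E for (@Num.conj C)}) (A B : operator E) : Prop :=
  (forall y, dom B y <->
     exists w, forall x, dom A x -> inner dot y (A x) = inner dot w x) /\
  (forall x y, dom A x -> dom B y -> inner dot y (A x) = inner dot (B y) x).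

Definition commut (V : zmodType) (A B : V -> V) (x : V) : V :=
  A (B x) - B (A x).

Definition stable (C : numDomainType) (E : lmodType C) (D : set E)
    (A : operator E) : Prop :=
  D `<=` dom A /\ (forall f, D f -> D (A f)).

Definition schauder_basis (C : numFieldType) (E : normedModType C)
    (u : nat -> E) : Prop :=
  forall f : E, exists! c : nat -> C,
    series (fun n => c n *: u n) @ \oo --> f.

Record ladder_setting (R : realType) (E : completeNormedModType R[i])
    (dot : {dot E for (@Num.conj R[i])}) (D : set E)
    (H T S Hd Td Sd : operator E) (lambda : R[i])
    (phi psi : nat -> E) (mu gamma : nat -> R[i]) : Prop := LadderSetting {
  (* E is a Hilbert space: its complete norm comes from the scalar product. *)
  ls_norm : forall x : E, `|x| ^+ 2 = inner dot x x;
  ls_adjH : is_adjoint dot H Hd;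
  ls_adjT : is_adjoint dot T Td;
  ls_adjS : is_adjoint dot S Sd;
  ls_D0 : D 0;
  ls_DP : forall (a : R[i]) (f g : E), D f -> D g -> D (a *: f + g);
  ls_dense : dense D;
  ls_stableH : stable D H;
  ls_stableT : stable D T;
  ls_stableS : stable D S;
  ls_stableHd : stable D Hd;
  ls_stableTd : stable D Td;
  ls_stableSd : stable D Sd;
  ls_commHS : forall f, D f -> commut H S f = lambda *: S (commut T S f);
  ls_commHT : forall f, D f -> commut H T f = lambda *: commut S T (T f);
  ls_commHTS : forall f, D f -> commut H (commut T S) f = 0;
  ls_nondeg : forall (e : R[i]) (f g : E), dom H f -> dom H g ->
    H f = e *: f -> H g = e *: g -> f != 0 -> exists c : R[i], g = c *: f;
  ls_phi0 : D (phi 0%N);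
  ls_Hphi0 : H (phi 0%N) = 0;
  ls_phiE : forall n, phi n = iter n S (phi 0%N);
  ls_phi_neq0 : forall n, phi n != 0;
  ls_commTS : forall n, commut T S (phi n) = mu n *: phi n;
  ls_mu_neq0 : forall n, mu n != 0;
  ls_phi_basis : schauder_basis phi;
  ls_psi_basis : schauder_basis psi;
  ls_biorth : forall n m, inner dot (phi n) (psi m) = (n == m)%:R;
  ls_psi_domSd : forall n, dom Sd (psi n);
  ls_Sdpsi0 : Sd (psi 0%N) = 0;
  ls_SdpsiS : forall n, Sd (psi n.+1) = psi n;
  ls_psi_domTd : forall n, dom Td (psi n);
  ls_Tdpsi : forall n, Td (psi n) = gamma n *: psi n.+1;
  ls_Tphi0 : T (phi 0%N) = 0;
  ls_TphiS : forall n, T (phi n.+1) = (gamma n)^* *: phi n }.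

(* gfact gamma n is gamma_{n-1}! = gamma_0 ... gamma_{n-1}; it is 1 at n = 0. *)
Definition gfact (C : comNzRingType) (gamma : nat -> C) (n : nat) : C :=
  \prod_(i < n) gamma i.

Definition phi_sum (R : realType) (E : normedModType R[i])
    (gamma : nat -> R[i]) (phi : nat -> E) (z : R[i]) : nat -> E :=
  series (fun n => (z ^+ n / (gfact gamma n)^*) *: phi n).

Definition psi_sum (R : realType) (E : normedModType R[i])
    (psi : nat -> E) (z : R[i]) : nat -> E :=
  series (fun n => z ^+ n *: psi n).

Definition Gamma_sum (R : realType) (gamma : nat -> R[i]) (z : R[i]) :
    nat -> R[i] :=
  series (fun n => `|z| ^+ (2 * n) / gfact gamma n).

Definition Gamma (R : realType) (gamma : nat -> R[i]) (z : R[i]) : R[i] :=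
  limn (Gamma_sum gamma z : nat -> R[i]^o).

(* Main.v *)
Require Import Defs.
From mathcomp Require Import all_boot all_order all_algebra.
From mathcomp Require Import all_classical all_reals all_analysis.
From mathcomp Require Import sesquilinear.
From mathcomp Require Import ring.
From mathcomp.real_closed Require Import complex.
Set Implicit Arguments.
Unset Strict Implicit.
Unset Printing Implicit Defensive.
Import Order.TTheory GRing.Theory Num.Theory.
Import numFieldNormedType.Exports.
Local Open Scope classical_set_scope.
Local Open Scope ring_scope.

(* Each radius of convergence comes from the ratio test: the majorants
   A r^n M_n / |gamma_{n-1}!| (resp. A r^n M_n, 1 / |gamma_{n-1}!|) have
   consecutive quotients tending to the stated radius (the square of it for
   Gamma), infinite values included.  The ladder relations turn the partial
   sums into approximate eigenvectors, T s_{n+1} = z s_n and S^dagger t_{n+1} =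
   z t_n.  Since an adjoint is closed, the second relation passes to the limit;
   the first one does so because T^dagger is densely defined, so that T is
   closable.  By biorthonormality <s_n, t_n> is the n-th partial sum of
   Gamma. *)

(** * Real-valued norms, absolute convergence and the ratio test *)

Section RealNorm.
Variable R : realType.

Lemma normE (V : normedZmodType R[i]) (x : V) : `|x| = (rnorm x)%:C%C.
Proof. by rewrite RRe_real// ger0_real. Qed.

Lemma rnorm_ge0 (V : normedZmodType R[i]) (x : V) : 0 <= rnorm x.
Proof. by rewrite -lecR -normE normr_ge0. Qed.

Lemma rnormZ (V : normedModType R[i]) (a : R[i]) (x : V) :
  rnorm (a *: x) = rnorm a * rnorm x.
Proof. by apply: complexI; rewrite rmorphM/= -!normE normrZ. Qed.

Lemma rnormM (a b : R[i]) : rnorm (a * b) = rnorm a * rnorm b.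
Proof. by apply: complexI; rewrite rmorphM/= -!normE normrM. Qed.

Lemma rnormX (a : R[i]) n : rnorm (a ^+ n) = rnorm a ^+ n.
Proof. by apply: complexI; rewrite rmorphXn/= -!normE normrX. Qed.

Lemma rnormV (a : R[i]) : rnorm a^-1 = (rnorm a)^-1.
Proof. by apply: complexI; rewrite fmorphV/= -!normE normfV. Qed.

Lemma rnormJ (a : R[i]) : rnorm a^* = rnorm a.
Proof. by rewrite /rnorm norm_conjC. Qed.

Lemma rnorm_norm (V : normedZmodType R[i]) (x : V) : rnorm `|x| = rnorm x.
Proof. by rewrite /rnorm normr_id. Qed.

Lemma rnorm_gt0 (a : R[i]) : a != 0 -> 0 < rnorm a.
Proof. by move=> a0; rewrite -ltcR -normE normr_gt0. Qed.

(** By the triangle inequality each block of the series is bounded by the same block of the series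
    of norms, so the Cauchy criterion carries over and completeness of [E] concludes. *)
Lemma cvg_rnorm_series (E : completeNormedModType R[i]) (u : nat -> E) :
  cvgn (series (fun n => rnorm (u n))) -> cvgn (series u).
Proof.
move=> /cauchy_cvgP/cauchy_seriesP ucvg.
apply/cauchy_cvgP/cauchy_seriesP => e e0.
(* A positive element of [R[i]] is real, so its real part serves as the tolerance in [R]. *)
have eE : e = (complex.Re e)%:C%C by rewrite RRe_real// gtr0_real.
have /ucvg : 0 < complex.Re e by rewrite -ltcR -eE.
apply: filterS => n /=; rewrite ger0_norm ?sumr_ge0//; last first.
  by move=> i _; exact: rnorm_ge0.
rewrite -ltcR -eE; apply: le_lt_trans; rewrite rmorph_sum/=.
rewrite (eq_bigr (fun i => `|u i|)) => [|i _]; first exact: ler_norm_sum.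
by rewrite -normE.
Qed.

Lemma cvg_complex (u : nat -> R[i]) (a b : R) :
  (fun n => complex.Re (u n)) @ \oo --> a ->
  (fun n => complex.Im (u n)) @ \oo --> b ->
  (u : nat -> R[i]^o) @ \oo --> ((a +i* b)%C : R[i]^o).
Proof.
move=> ua ub; apply/cvgrPdist_lt => e e0.
have eE : e = (complex.Re e)%:C%C by rewrite RRe_real// gtr0_real.
have re0 : 0 < complex.Re e / 2 by rewrite divr_gt0// -ltcR -eE.
near=> n.
have an : `|a - complex.Re (u n)| < complex.Re e / 2.
  by near: n; move/cvgrPdist_lt : ua; apply.
have bn : `|b - complex.Im (u n)| < complex.Re e / 2.
  by near: n; move/cvgrPdist_lt : ub; apply.
rewrite [ltLHS](_ : _ =
  `|(a - complex.Re (u n))%:C%C + 'i%C * (b - complex.Im (u n))%:C%C|);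
  last first.
  by congr (`| _ |); case: (u n) => c d; simpc.
apply: (le_lt_trans (ler_normD _ _)).
rewrite normrM !normc_def/= expr0n/= !addr0 !sqrtr_sqr.
rewrite add0r expr1n sqrtr1 mul1r -rmorphD/= eE ltcR.
by rewrite [ltRHS]splitr ltrD.
Unshelve. all: by end_near. Qed.

(** Real and imaginary parts are dominated by the modulus, so both real series converge absolutely;
    [cvg_complex] reassembles their sums. *)
Lemma cvg_rnorm_series_complex (u : nat -> R[i]) :
  cvgn (series (fun n => rnorm (u n))) -> cvgn (series u : nat -> R[i]^o).
Proof.
move=> ucvg.
have cvg_part (p : R[i] -> R) : (forall x, `|p x| <= rnorm x) ->
    cvgn (series (fun n => p (u n))).
  move=> pu; apply: normed_cvg; apply: series_le_cvg ucvg => n /=.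
  - exact: normr_ge0.
  - exact: rnorm_ge0.
  - exact: pu.
have Re_le (x : R[i]) : `|complex.Re x| <= rnorm x.
  by rewrite -lecR -normE normc_ge_Re.
have Im_le (x : R[i]) : `|complex.Im x| <= rnorm x.
  (* Multiplication by ['i%C] preserves the modulus and turns the imaginary part, up to sign, into a
     real part, so that [Re_le] applies. *)
  have <- : rnorm (x * 'i%C) = rnorm x.
    rewrite rnormM /rnorm (normc_def 'i%C)/= expr0n/=.
    by rewrite add0r expr1n sqrtr1 mulr1.
  by rewrite -normrN -ReiNIm.
have /cvg_ex[a ua] := cvg_part _ Re_le.
have /cvg_ex[b ub] := cvg_part _ Im_le.
apply/cvg_ex; exists ((a +i* b)%C : R[i]^o); apply: cvg_complex.
- rewrite (_ : (fun n => _) = series (fun n => complex.Re (u n)))//.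
  apply/funext; elim=> [|n IHn]; first by rewrite /series/= !big_geq.
  by rewrite !seriesSr -IHn; case: (u n) (series u n) => ? ? [].
- rewrite (_ : (fun n => _) = series (fun n => complex.Im (u n)))//.
  apply/funext; elim=> [|n IHn]; first by rewrite /series/= !big_geq.
  by rewrite !seriesSr -IHn; case: (u n) (series u n) => ? ? [].
Qed.

(** For [q] strictly between [x] and [L], the sequence [u n * q ^+ n] is eventually nonincreasing,
    hence bounded by some [C]; then [v] is dominated by a geometric series of ratio [x / q < 1]. *)
Lemma ratio_test (u v : nat -> R) (A x : R) (L : \bar R) :
  (forall n, 0 < u n) -> (u n / u n.+1)%:E @[n --> \oo] --> L ->
  0 <= x -> (x%:E < L)%E -> 0 <= A ->
  (forall n, 0 <= v n <= A * (x ^+ n * u n)) -> cvgn (series v).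
Proof.
move=> u0 uL x0 xL A0 vu.
have [q xq qL] : exists2 q, x < q & (q%:E < L)%E.
  case: L xL {uL} => [l| |//]; rewrite ?lte_fin => xl.
    by exists ((x + l) / 2); rewrite ?lte_fin ?midf_lt.
  by exists (x + 1); rewrite ?ltry// ltrDl.
have q0 : 0 < q by exact: le_lt_trans xq.
have [N _ uN] : \forall n \near \oo, q < u n / u n.+1.
  have : \forall n \near \oo, (q%:E < (u n / u n.+1)%:E)%E.
    by apply: (uL [set y | (q%:E < y)%E]); exact: open_ereal_gt'.
  by apply: filterS => n; rewrite lte_fin.
have uq k : u (N + k)%N * q ^+ (N + k) <= u N * q ^+ N.
  elim: k => [|k]; first by rewrite addn0.
  apply: le_trans; rewrite addnS exprS mulrA ler_wpM2r ?exprn_ge0 1?ltW//.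
  by rewrite mulrC -ltr_pdivlMr//; apply: uN; rewrite /= leq_addr.
(* The terms are nonnegative, so this sum bounds each term up to index [N]; by [uq], later terms do
   not exceed the one of index [N]. *)
pose C := \sum_(i < N.+1) u i * q ^+ i.
have uq0 i : 0 <= u i * q ^+ i by rewrite mulr_ge0 ?exprn_ge0 1?ltW.
have uC n : u n * q ^+ n <= C.
  have le_C m : (m < N.+1)%N -> u m * q ^+ m <= C.
    by move=> mN; rewrite /C (bigD1 (Ordinal mN))//= lerDl sumr_ge0.
  have [nN|/ltnW nN] := leqP n N; first exact: le_C.
  by rewrite -(subnKC nN) (le_trans (uq _))// le_C.
have C0 : 0 <= C by rewrite sumr_ge0.
have xq0 : 0 <= x / q by rewrite divr_ge0// ltW.
apply: (@series_le_cvg _ v (geometric (A * C) (x / q))).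
- by move=> n; case/andP : (vu n).
- by move=> n; rewrite /= mulr_ge0 ?mulr_ge0 ?exprn_ge0.
- move=> n; case/andP : (vu n) => _ /le_trans; apply.
  rewrite /= -mulrA ler_wpM2l// expr_div_n mulrCA ler_wpM2l ?exprn_ge0//.
  by rewrite ler_pdivlMr ?exprn_gt0.
apply: is_cvg_geometric_series.
by rewrite ger0_norm// ltr_pdivrMr// mul1r.
Qed.

End RealNorm.

(** * Continuity of the scalar product, closedness of adjoints *)

Section DotProduct.
Variables (R : realType) (E : completeNormedModType R[i]).
Variable dot : {dot E for (@Num.conj R[i])}.
Hypothesis normE2 : forall x : E, `|x| ^+ 2 = inner dot x x.

Lemma dot_conj (x y : E) : dot x y = (dot y x)^*.
Proof. by rewrite (hermC dot) expr0 mul1r. Qed.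

Lemma dotZr (a : R[i]) (x y : E) : dot x (a *: y) = a^* * dot x y.
Proof. exact: linearZr_LR. Qed.

Lemma dotZl (a : R[i]) (x y : E) : dot (a *: x) y = a * dot x y.
Proof. exact: linearZl_LR. Qed.

Lemma Cauchy_Schwarz (x y : E) : `|dot x y| <= `|x| * `|y|.
Proof.
have [->|y0] := eqVneq y 0.
  by rewrite linear0r normr0 mulr_ge0.
have yy0 : 0 < `|y| ^+ 2 by rewrite exprn_gt0 ?normr_gt0.
have yyJ : (`|y| ^+ 2)^* = `|y| ^+ 2.
  by rewrite rmorphXn/=; congr (_ ^+ 2); apply/CrealP; exact: normr_real.
rewrite -(@ler_pXn2r _ 2) ?nnegrE ?mulr_ge0// exprMn -ler_pdivrMr// -subr_ge0.
(* The coefficient of the orthogonal projection of [x] on [y]: the difference in the goal is the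
   squared norm of [x - a *: y]. *)
pose a := dot x y / `|y| ^+ 2.
have : 0 <= dot (x - a *: y) (x - a *: y).
  by rewrite -[leRHS]normE2 exprn_ge0.
rewrite linearBl/= !linearBr/= !dotZl !dotZr.
rewrite -[dot x x]normE2 -[dot y y]normE2 (dot_conj y x).
rewrite /a rmorphM/= fmorphV/= yyJ normCK.
move: (`|y| ^+ 2) yy0 => t t0; congr (0 <= _).
by field; rewrite gt_eqF.
Qed.

(** By Cauchy-Schwarz the error is at most [|x - u n| |v n| + |x| |y - v n|], which tends to 0. *)
Lemma cvg_dot (u v : nat -> E) (x y : E) : u @ \oo --> x -> v @ \oo --> y ->
  (fun n => dot (u n) (v n) : R[i]^o) @ \oo --> (dot x y : R[i]^o).
Proof.
move=> ux vy.
have cvg_diff (w : nat -> E) z : w @ \oo --> z ->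
    (fun n => `|z - w n| : R[i]^o) @ \oo --> (0 : R[i]^o).
  move=> wz; have -> : (0 : R[i]^o) = `|z - z| by rewrite subrr normr0.
  by apply: cvg_norm; apply: cvgB => //; exact: cvg_cst.
have bound_cvg :
    (fun n => `|x - u n| * `|v n| + `|x| * `|y - v n| : R[i]^o) @ \oo -->
    (0 : R[i]^o).
  have -> : (0 : R[i]^o) = 0 * `|y| + `|x| * 0 by rewrite mul0r mulr0 addr0.
  apply: (@cvgD _ R[i]^o); apply: (@cvgM R[i]).
  - exact: cvg_diff.
  - exact: cvg_norm.
  - exact: cvg_cst.
  - exact: cvg_diff.
apply/cvgrPdist_lt => e e0.
move/cvgrPdist_lt : bound_cvg => /(_ e e0); apply: filterS => n /=.
rewrite sub0r normrN ger0_norm ?addr_ge0 ?mulr_ge0//; apply: le_lt_trans.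
rewrite (_ : dot x y - _ = dot (x - u n) (v n) + dot x (y - v n)).
  by apply: (le_trans (ler_normD _ _)); rewrite lerD// Cauchy_Schwarz.
by rewrite linearBl/= linearBr/= [RHS]addrC addrA subrK.
Qed.

(** The device by which an adjointness relation, valid along sequences, passes to their limits. *)
Lemma dot_cvg_unique (u v u' v' : nat -> E) (x y x' y' : E) :
  u @ \oo --> x -> v @ \oo --> y -> u' @ \oo --> x' -> v' @ \oo --> y' ->
  (forall n, dot (u n) (v n) = dot (u' n) (v' n)) -> dot x y = dot x' y'.
Proof.
move=> ux vy ux' vy' uv.
apply: (cvg_unique (@norm_hausdorff _ R[i]^o) (cvg_dot ux vy)).
by rewrite (funext uv); exact: cvg_dot.
Qed.

(** Otherwise some [y] in [D] satisfies [|x - y| < |x|], and orthogonality gives [|x|^2 = dot (x -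
    y) x <= |x - y| |x| < |x|^2]. *)
Lemma dense_dot_eq0 (D : set E) (x : E) :
  dense D -> (forall y, D y -> dot y x = 0) -> x = 0.
Proof.
move=> denseD Dx; apply/eqP/negPn/negP => x0.
have x_gt0 : 0 < `|x| by rewrite normr_gt0.
have [||y [/interior_subset]] := denseD (interior (ball x `|x|)).
- by exists x; exact: nbhsx_ballx.
- exact: open_interior.
rewrite -ball_normE/= => xy Dy.
have : `|x| ^+ 2 < `|x| ^+ 2; last by rewrite ltxx.
rewrite [ltLHS]normE2 /inner -[dot x x]subr0 -(Dx y Dy) -linearBl/=.
rewrite -[ltLHS]ger0_norm; last first.
  by rewrite linearBl/= (Dx y Dy) subr0 -[leRHS]normE2 exprn_ge0.
by rewrite (le_lt_trans (Cauchy_Schwarz _ _))// expr2 ltr_pM2r.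
Qed.

(** In the limit, [y] represents the functional that [x] induces through [A], which puts [x] in
    [dom B]; density of [D] then forces [B x = y]. *)
Lemma adjoint_closed (A B : operator E) (D : set E) (u : nat -> E) (x y : E) :
  is_adjoint dot A B -> dense D -> D `<=` dom A -> (forall n, dom B (u n)) ->
  u @ \oo --> x -> (fun n => B (u n)) @ \oo --> y -> dom B x /\ B x = y.
Proof.
move=> [domB AB] denseD DA Bu ux Buy.
have xy w : dom A w -> dot (A w) x = dot w y.
  move=> Aw.
  apply: (dot_cvg_unique (@cvg_cst _ _ _ _ _) ux (@cvg_cst _ _ _ _ _) Buy) => n.
  exact: AB.
have Bx : dom B x by apply/domB; exists y.
split=> //; apply/eqP; rewrite -subr_eq0; apply/eqP.
apply: (dense_dot_eq0 denseD) => w /DA Aw.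
by rewrite linearBr/= -[dot w (B x)](AB w x)// -xy// subrr.
Qed.

(** Tested against the dense set [D] inside [dom B], the vectors [A x] and [y] have the same scalar
    products. As [A] may fail to be closed, [dom A x] has to be assumed here. *)
Lemma adjoint_closable (A B : operator E) (D : set E) (u : nat -> E) (x y : E) :
  is_adjoint dot A B -> dense D -> D `<=` dom B -> (forall n, dom A (u n)) ->
  u @ \oo --> x -> (fun n => A (u n)) @ \oo --> y -> dom A x -> A x = y.
Proof.
move=> [_ AB] denseD DB Au ux Auy Ax.
apply/eqP; rewrite -subr_eq0; apply/eqP.
apply: (dense_dot_eq0 denseD) => w /DB Bw; rewrite linearBr/=.
suff : dot (A x) w = dot y w.
  by rewrite (dot_conj w) (dot_conj w y) => ->; rewrite subrr.
rewrite -[LHS]/(inner dot w (A x)) AB//.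
apply: (dot_cvg_unique ux (@cvg_cst _ _ _ _ _) Auy (@cvg_cst _ _ _ _ _)) => n.
by rewrite -[RHS]/(inner dot w (A (u n))) AB.
Qed.

End DotProduct.

(** * Operators on finite sums *)

Lemma act0 (C : numDomainType) (E : lmodType C) (A : operator E) : A 0 = 0.
Proof.
have := actP 1 (dom0 A) (dom0 A); rewrite !scale1r addr0 => A0.
by apply: (addrI (A 0)); rewrite addr0 -A0.
Qed.

Lemma act_series (C : numFieldType) (E : normedModType C) (A : operator E)
    (a : nat -> C) (v : nat -> E) n : (forall k, dom A (v k)) ->
  dom A (series (fun k => a k *: v k) n) /\
  A (series (fun k => a k *: v k) n) = series (fun k => a k *: A (v k)) n.
Proof.
move=> Av; elim: n => [|n [IHd IHA]].
  by rewrite /series/= !big_geq//; split; [exact: dom0|exact: act0].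
rewrite !seriesSr addrC; split; first exact: domP.
by rewrite actP// IHA addrC.
Qed.

Lemma gfactS (C : comNzRingType) (gamma : nat -> C) n :
  gfact gamma n.+1 = gfact gamma n * gamma n.
Proof. by rewrite /gfact big_ord_recr. Qed.

(** * Ladder relations for the partial sums, and the radii of convergence *)

Section Ladder.
Variables (R : realType) (E : completeNormedModType R[i]).
Variables (dot : {dot E for (@Num.conj R[i])}) (D : set E).
Variables (H T S Hd Td Sd : operator E) (lambda : R[i]).
Variables (phi psi : nat -> E) (mu gamma : nat -> R[i]).
Hypothesis setting :
  ladder_setting dot D H T S Hd Td Sd lambda phi psi mu gamma.
Hypothesis gamma_neq0 : forall n, gamma n != 0.

Lemma gfact_neq0 n : gfact gamma n != 0.
Proof. by apply/prodf_neq0 => i _. Qed.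

Lemma phi_D n : D (phi n).
Proof.
elim: n => [|n]; first exact: (ls_phi0 setting).
rewrite (ls_phiE setting n.+1) /= -(ls_phiE setting n) => Dn.
by have [_ SD] := ls_stableS setting; exact: SD.
Qed.

(** [T] kills the term of index 0 and lowers the others by one, its factor cancelling the last
    factor of the conjugated factorial. Since [series] at [n] has [n] terms, one term is lost. *)
Lemma T_phi_sum z n : dom T (phi_sum gamma phi z n) /\
  T (phi_sum gamma phi z n.+1) = z *: phi_sum gamma phi z n.
Proof.
have domT k : dom T (phi k).
  by case: (ls_stableT setting) => + _; apply; exact: phi_D.
pose c k := z ^+ k / (gfact gamma k)^*.
split; first by have [] := act_series c n domT.
have [_ ->] := act_series c n.+1 domT; rewrite {}/c.
elim: n => [|n IHn].
  by rewrite /phi_sum /series/= big_nat1 big_geq// (ls_Tphi0 setting) !scaler0.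
rewrite seriesSr IHn /phi_sum [in RHS]seriesSr scalerDr; congr (_ + _).
rewrite (ls_TphiS setting) !scalerA gfactS rmorphM/= exprS; congr (_ *: _).
by field; rewrite !conjC_eq0 gamma_neq0 gfact_neq0.
Qed.

Lemma Sd_psi_sum z n : dom Sd (psi_sum psi z n) /\
  Sd (psi_sum psi z n.+1) = z *: psi_sum psi z n.
Proof.
have domS := ls_psi_domSd setting.
split; first by have [] := act_series (fun k => z ^+ k) n domS.
have [_ ->] := act_series (fun k => z ^+ k) n.+1 domS.
elim: n => [|n IHn].
  by rewrite /psi_sum /series/= big_nat1 big_geq// (ls_Sdpsi0 setting) !scaler0.
rewrite seriesSr IHn /psi_sum [in RHS]seriesSr scalerDr; congr (_ + _).
by rewrite (ls_SdpsiS setting) scalerA exprS.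
Qed.

(** Only diagonal terms survive biorthogonality. The form is conjugate-linear in the [phi] slot,
    which turns the conjugated factorials into those of [Gamma_sum] and yields [z] times its
    conjugate. *)
Lemma dot_psi_phi_sum z n :
  dot (psi_sum psi z n) (phi_sum gamma phi z n) = Gamma_sum gamma z n.
Proof.
rewrite /psi_sum /phi_sum /Gamma_sum /series/= !big_mkord linear_sumlz/=.
apply: eq_bigr => i _; rewrite linear_sumr/= (bigD1 i)//= big1 ?addr0.
  rewrite (dotZl dot) (dotZr dot) -[dot _ _]/(inner dot (phi i) (psi i)).
  rewrite (ls_biorth setting) eqxx mulr1 rmorphM/= fmorphV/= conjCK rmorphXn/=.
  by rewrite mulrA -exprMn -normCK exprM.
move=> j ji; rewrite (dotZl dot) (dotZr dot).
rewrite -[dot _ _]/(inner dot (phi j) (psi i)) (ls_biorth setting).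
by rewrite -[(_ == _)]/(j == i) (negbTE ji) !mulr0.
Qed.

Lemma cvg_phi_sum (g M : \bar R) (A r : R) (m : nat -> R) (z : R[i]) :
  (rnorm (gamma n))%:E @[n --> \oo] --> g -> 0 < A -> 0 < r ->
  (forall n, 0 < m n) -> (m n / m n.+1)%:E @[n --> \oo] --> M ->
  (forall n, rnorm (phi n) <= A * r ^+ n * m n) ->
  ((rnorm z)%:E < g * M * (r^-1)%:E)%E -> cvgn (phi_sum gamma phi z).
Proof.
move=> gg A0 r0 m0 mM phi_le zL; apply: cvg_rnorm_series.
have g0 n : 0 < rnorm (gamma n) by exact: rnorm_gt0.
have gf0 n : 0 < rnorm (gfact gamma n) by rewrite rnorm_gt0// gfact_neq0.
pose u n := r ^+ n * m n / rnorm (gfact gamma n).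
(* The radius exceeds a nonnegative number; this excludes the indeterminate products of 0 and
   infinity when limits are multiplied in the extended reals. *)
have rad_neq0 : (g * M * (r^-1)%:E != 0)%E.
  by rewrite gt_eqF// (le_lt_trans _ zL)// lee_fin rnorm_ge0.
apply: (@ratio_test _ u _ A (rnorm z) _ _ _ _ zL).
- by move=> n; rewrite divr_gt0 ?mulr_gt0 ?exprn_gt0.
- have -> : (fun n => (u n / u n.+1)%:E) = (fun n => (rnorm (gamma n))%:E *
      (m n / m n.+1)%:E * (r^-1)%:E)%E.
    apply/funext => n; rewrite -!EFinM; congr (_%:E).
    rewrite /u gfactS rnormM exprS.
    move: (rnorm (gfact gamma n)) (rnorm (gamma n)) (gf0 n) (g0 n) => a b a0 b0.
    by field; rewrite !gt_eqF ?exprn_gt0.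
  apply: cvgeM; [exact: neq0_mule_def| |exact: cvg_cst].
  apply: cvgeM => //; apply: neq0_mule_def.
  by apply: contra_neq rad_neq0 => ->; rewrite mul0e.
- exact: rnorm_ge0.
- exact: ltW.
- move=> n; rewrite rnorm_ge0/= rnormZ rnormM rnormV rnormJ rnormX /u.
  rewrite [leRHS](_ : _ = rnorm z ^+ n / rnorm (gfact gamma n) *
    (A * r ^+ n * m n)); last by ring.
  by rewrite ler_wpM2l// divr_ge0 ?exprn_ge0 ?rnorm_ge0.
Qed.

Lemma cvg_Gamma_sum (g : \bar R) (z : R[i]) :
  (rnorm (gamma n))%:E @[n --> \oo] --> g ->
  ((rnorm z)%:E < sqrte g)%E -> cvgn (Gamma_sum gamma z : nat -> R[i]^o).
Proof.
move=> gg zg; apply: cvg_rnorm_series_complex.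
have gf0 n : 0 < rnorm (gfact gamma n) by rewrite rnorm_gt0// gfact_neq0.
pose u n := (rnorm (gfact gamma n))^-1.
(* The terms have modulus [(|z|^2)^n / |gamma_{n-1}!|], so the ratio test compares [|z|^2] with
   [g]. *)
have zg2 : ((rnorm z ^+ 2)%:E < g)%E.
  have g0 : (0 <= g)%E.
    by apply: cvge_ge gg; apply: nearW => n; rewrite lee_fin rnorm_ge0.
  case: g g0 zg {gg} => [l||]//= l0; rewrite ?ltry// !lte_fin => zl.
  by rewrite -(sqr_sqrtr l0) ltr_pXn2r ?nnegrE ?rnorm_ge0 ?sqrtr_ge0.
apply: (@ratio_test _ u _ 1 (rnorm z ^+ 2) _ _ _ _ zg2) => //.
- by move=> n; rewrite invr_gt0.
- apply: cvg_trans gg; apply: near_eq_cvg; apply: nearW => n.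
  by rewrite /u gfactS rnormM invrK mulKf// gt_eqF.
- by rewrite exprn_ge0// rnorm_ge0.
- move=> n; rewrite rnorm_ge0 mul1r rnormM rnormV rnormX rnorm_norm /u.
  by rewrite exprM lexx.
Qed.

End Ladder.

Lemma cvg_psi_sum (R : realType) (E : completeNormedModType R[i])
    (psi : nat -> E) (M : \bar R) (A r : R) (m : nat -> R) (z : R[i]) :
  0 < A -> 0 < r ->
  (forall n, 0 < m n) -> (m n / m n.+1)%:E @[n --> \oo] --> M ->
  (forall n, rnorm (psi n) <= A * r ^+ n * m n) ->
  ((rnorm z)%:E < M * (r^-1)%:E)%E -> cvgn (psi_sum psi z).
Proof.
move=> A0 r0 m0 mM psi_le zL; apply: cvg_rnorm_series.
pose u n := r ^+ n * m n.
have rad_neq0 : (M * (r^-1)%:E != 0)%E.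
  by rewrite gt_eqF// (le_lt_trans _ zL)// lee_fin rnorm_ge0.
apply: (@ratio_test _ u _ A (rnorm z) _ _ _ _ zL).
- by move=> n; rewrite mulr_gt0 ?exprn_gt0.
- have -> : (fun n => (u n / u n.+1)%:E) =
      (fun n => (m n / m n.+1)%:E * (r^-1)%:E)%E.
    apply/funext => n; rewrite -!EFinM; congr (_%:E).
    by rewrite /u exprS; field; rewrite !gt_eqF ?exprn_gt0.
  by apply: cvgeM; [exact: neq0_mule_def| |exact: cvg_cst].
- exact: rnorm_ge0.
- exact: ltW.
- move=> n; rewrite rnorm_ge0/= rnormZ rnormX /u [leRHS]mulrCA.
  by rewrite ler_wpM2l ?exprn_ge0 ?rnorm_ge0// mulrA.
Qed.

(** [T] is not assumed closed, so the limit [phiz] might leave [dom T]. The eigenvalue equation is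
    therefore stated for the closure of the graph, and for [T] itself once [phiz] lies in its
    domain. [Sd] is an adjoint, hence closed, and calls for no such reservation. *)
Theorem mainTheorem6 (R : realType) (E : completeNormedModType R[i])
    (dot : {dot E for (@Num.conj R[i])}) (D : set E)
    (H T S Hd Td Sd : operator E) (lambda : R[i])
    (phi psi : nat -> E) (mu gamma : nat -> R[i])
    (setting : ladder_setting dot D H T S Hd Td Sd lambda phi psi mu gamma)
    (gamma_neq0 : forall n, gamma n != 0)
    (g : \bar R) (gammalim : (rnorm (gamma n))%:E @[n --> \oo] --> g)
    (Aphi Apsi rphi rpsi : R)
    (Aphi_gt0 : 0 < Aphi) (Apsi_gt0 : 0 < Apsi)
    (rphi_gt0 : 0 < rphi) (rpsi_gt0 : 0 < rpsi)
    (mphi mpsi : nat -> R)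
    (mphi_gt0 : forall n, 0 < mphi n) (mpsi_gt0 : forall n, 0 < mpsi n)
    (Mphi Mpsi : \bar R)
    (mphi_lim : (mphi n / mphi n.+1)%:E @[n --> \oo] --> Mphi)
    (mpsi_lim : (mpsi n / mpsi n.+1)%:E @[n --> \oo] --> Mpsi)
    (Mphi_gt0 : (0 < Mphi)%E) (Mpsi_gt0 : (0 < Mpsi)%E)
    (phi_le : forall n, rnorm (phi n) <= Aphi * rphi ^+ n * mphi n)
    (psi_le : forall n, rnorm (psi n) <= Apsi * rpsi ^+ n * mpsi n) :
  let rad_phi := (g * Mphi * (rphi^-1)%:E)%E in
  let rad_psi := (Mpsi * (rpsi^-1)%:E)%E in
  let rho := Order.min rad_phi (Order.min rad_psi (sqrte g)) in
  (forall z : R[i], ((rnorm z)%:E < rad_phi)%E -> cvgn (phi_sum gamma phi z)) /\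
  (forall z : R[i], ((rnorm z)%:E < rad_psi)%E -> cvgn (psi_sum psi z)) /\
  (forall z : R[i], ((rnorm z)%:E < sqrte g)%E ->
     cvgn (Gamma_sum gamma z : nat -> R[i]^o)) /\
  (forall z : R[i], ((rnorm z)%:E < rho)%E ->
     [/\ cvgn (phi_sum gamma phi z), cvgn (psi_sum psi z)
       & cvgn (Gamma_sum gamma z : nat -> R[i]^o)]) /\
  (forall z : R[i], ((rnorm z)%:E < rho)%E -> Gamma gamma z != 0 ->
   forall Nphi Npsi : R[i], Nphi^* * Npsi = (Gamma gamma z)^-1 ->
   let phiz := Nphi *: limn (phi_sum gamma phi z) in
   let psiz := Npsi *: limn (psi_sum psi z) in
   [/\ inner dot phiz psiz = 1,
       closure (graph T) (phiz, z *: phiz)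
       /\ (closed (graph T) -> dom T phiz)
       /\ (dom T phiz -> T phiz = z *: phiz)
     & dom Sd psiz /\ Sd psiz = z *: psiz]).
Proof.
move=> rad_phi rad_psi rho.
have cvg_phi z : ((rnorm z)%:E < rad_phi)%E -> cvgn (phi_sum gamma phi z).
  exact: (cvg_phi_sum gamma_neq0 gammalim Aphi_gt0 rphi_gt0 mphi_gt0).
have cvg_psi z : ((rnorm z)%:E < rad_psi)%E -> cvgn (psi_sum psi z).
  exact: (cvg_psi_sum Apsi_gt0 rpsi_gt0 mpsi_gt0).
have cvg_Gamma z : ((rnorm z)%:E < sqrte g)%E ->
    cvgn (Gamma_sum gamma z : nat -> R[i]^o).
  exact: (cvg_Gamma_sum gamma_neq0).
have cvg_rho z : ((rnorm z)%:E < rho)%E ->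
    [/\ cvgn (phi_sum gamma phi z), cvgn (psi_sum psi z)
      & cvgn (Gamma_sum gamma z : nat -> R[i]^o)].
  rewrite !lt_min => /and3P[zphi zpsi zGamma].
  by split; [exact: cvg_phi|exact: cvg_psi|exact: cvg_Gamma].
do 4!split=> //.
move=> z /cvg_rho[cphi cpsi cGamma] Gamma0 Nphi Npsi NN phiz psiz.
have normE2 := ls_norm setting.
have phi_lim : (fun n => Nphi *: phi_sum gamma phi z n) @ \oo --> phiz.
  by apply: cvgZl_tmp.
have psi_lim : (fun n => Npsi *: psi_sum psi z n) @ \oo --> psiz.
  by apply: cvgZl_tmp.
have denseD := ls_dense setting.
(* The ladder relation replaces continuity of [T]: the images are [z] times the previous partial
   sums, whose limit is known. *)
have T_lim : (fun n => T (Nphi *: phi_sum gamma phi z n.+1)) @ \oo -->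
    z *: phiz.
  have -> : (fun n => T (Nphi *: phi_sum gamma phi z n.+1)) =
      (fun n => z *: (Nphi *: phi_sum gamma phi z n)).
    apply/funext => n; have [[Td1 _] [_ TS]] :=
      (T_phi_sum setting gamma_neq0 z n.+1, T_phi_sum setting gamma_neq0 z n).
    have := actP Nphi Td1 (dom0 T); rewrite act0 !addr0 => ->.
    by rewrite TS !scalerA mulrC.
  by apply: cvgZl_tmp.
have Sd_lim : (fun n => Sd (Npsi *: psi_sum psi z n.+1)) @ \oo --> z *: psiz.
  have -> : (fun n => Sd (Npsi *: psi_sum psi z n.+1)) =
      (fun n => z *: (Npsi *: psi_sum psi z n)).
    apply/funext => n; have [[Sd1 _] [_ SS]] :=
      (Sd_psi_sum setting z n.+1, Sd_psi_sum setting z n).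
    have := actP Npsi Sd1 (dom0 Sd); rewrite act0 !addr0 => ->.
    by rewrite SS !scalerA mulrC.
  by apply: cvgZl_tmp.
have domT n : dom T (Nphi *: phi_sum gamma phi z n.+1).
  have [T1 _] := T_phi_sum setting gamma_neq0 z n.+1.
  by rewrite -[X in dom T X]addr0; apply: domP => //; exact: dom0.
have domSd n : dom Sd (Npsi *: psi_sum psi z n.+1).
  have [S1 _] := Sd_psi_sum setting z n.+1.
  by rewrite -[X in dom Sd X]addr0; apply: domP => //; exact: dom0.
(* The limits are reindexed to match the sums with [n.+1] terms to which [T] and [Sd] are
   applied. *)
rewrite -cvg_shiftS in phi_lim; rewrite -cvg_shiftS in psi_lim.
have graphT : closure (graph T) (phiz, z *: phiz).
  apply: (@closed_cvg _ (E * E)%type \oo _ (fun n =>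
    (Nphi *: phi_sum gamma phi z n.+1, T (Nphi *: phi_sum gamma phi z n.+1)))
    _ (@closed_closure _ (graph T))); last exact: cvg_pair phi_lim T_lim.
  by apply: nearW => n; apply: subset_closure; split; first exact: domT.
split.
- rewrite /inner (dotZl dot) (dotZr dot).
  suff -> : dot (limn (psi_sum psi z)) (limn (phi_sum gamma phi z)) =
      Gamma gamma z by rewrite mulrA (mulrC Npsi) NN mulVf.
  (* The products of the partial sums are the partial sums of [Gamma], so the two limits agree. *)
  apply: (cvg_unique (@norm_hausdorff _ R[i]^o) (cvg_dot normE2 cpsi cphi)).
  by rewrite (funext (dot_psi_phi_sum setting z)).
- split=> //; split=> [/closure_id clT|].
    by move: graphT; rewrite -clT => -[].
  apply: (adjoint_closable normE2 (ls_adjT setting) denseD _ domT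
    phi_lim T_lim).
  by case: (ls_stableTd setting).
- apply: (adjoint_closed normE2 (ls_adjS setting) denseD _ domSd
    psi_lim Sd_lim).
  by case: (ls_stableS setting).
Qed.
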